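(* Let $(\mathfrak{g},[\cdot,\cdot])$ be a finite dimensional nilpotent Lie algebra over a field $\mathbb{F}$ of characteristic zero. Let $f$ be an invariant, symmetric and non-zero bilinear form on $\mathfrak{g}$. Let $\mathcal{A}_f=\mathbb{F}\times\mathfrak{g}$ be the algebra (with componentwise vector space structure) with product $$(\xi,x)(\eta,y)=\Big(\xi\eta+f(x,y),\ \xi y+\eta x+\tfrac12[x,y]\Big)\qquad(\xi,\eta\in\mathbb{F},\ x,y\in\mathfrak{g}).$$ (i) If $\dim\mathfrak{g}>1$, then $f$ is non-degenerate if and only if $\mathcal{A}_f$ is a simple algebra. (ii) Let $[\cdot,\cdot]_f$ be the commutator of the product of $\mathcal{A}_f$. Then $\mathcal{A}_f/\mathbb{F}(1,0)$, with the bracket induced by $[\cdot,\cdot]_f$, is a Lie algebra isomorphic to $(\mathfrak{g},[\cdot,\cdot])$.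
   Context: A bilinear form $f$ on $\mathfrak{g}$ is invariant if $f([x,y],z)=-f(y,[x,z])$ for all $x,y,z\in\mathfrak{g}$. Algebras here are not necessarily associative; an algebra with unit is simple if it has no two-sided ideals other than $\{0\}$ and itself. The commutator is $[a,b]_f=ab-ba$ for $a,b\in\mathcal{A}_f$. *)

(* Defs.v *)
From HB Require Import structures.
From mathcomp Require Import all_boot all_algebra.
From mathcomp Require Import generic_quotient ring_quotient.

Set Implicit Arguments.
Unset Strict Implicit.
Unset Printing Implicit Defensive.

Import GRing.Theory.
Local Open Scope ring_scope.
Local Open Scope quotient_scope.

Section LieBracket.
Variables (F : fieldType).

Definition is_lie_bracket (V : lmodType F) (br : V -> V -> V) : Prop :=
  [/\ bilinear_for *:%R *:%R br,
      forall x, br x x = 0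
    & forall x y z, br x (br y z) + br y (br z x) + br z (br x y) = 0].

Definition lie_isomorphic (V W : lmodType F)
    (brV : V -> V -> V) (brW : W -> W -> W) : Prop :=
  exists phi : {linear V -> W},
    bijective phi /\ {morph phi : x y / brV x y >-> brW x y}.

End LieBracket.

Section Nilpotent.
Variables (F : fieldType) (g : vectType F) (br : g -> g -> g).

(* The span of all br x y with x \in U and y \in V, built from bases in the
   style of the product of subspaces in falgebra; bracketvP is its universal
   property. *)
Definition bracketv (U V : {vspace g}) : {vspace g} :=
  <<[seq br x y | x <- vbasis U, y <- vbasis V]>>%VS.

Lemma bracketvP (U V W : {vspace g}) : bilinear_for *:%R *:%R br ->
  reflect {in U & V, forall x y, br x y \in W} (bracketv U V <= W)%VS.
Proof.
move=> [brl brr].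
pose brm (x : g) : {linear g -> g} :=
  HB.pack (br x) (GRing.isLinear.Build F g g _ (br x) (brr x)).
pose brn (y : g) : {linear g -> g} :=
  HB.pack (br ^~ y) (GRing.isLinear.Build F g g _ (br ^~ y) (brl y)).
apply: (iffP span_subvP) => [sW x y xU yV | sW z /allpairsP[[x y] /= [xU yV ->]]];
  last by apply: sW; rewrite vbasis_mem.
rewrite (coord_vbasis xU) -[br _ y]/(brn y _) linear_sum; apply: memv_suml => i _.
rewrite linearZ memvZ //= (coord_vbasis yV) -[br _ _]/(brm _ _) linear_sum.
apply: memv_suml => j _; rewrite linearZ memvZ //=; apply: sW.
by apply: allpairs_f; rewrite mem_nth ?size_tuple.
Qed.

Fixpoint lower_central (k : nat) : {vspace g} :=
  if k is k'.+1 then bracketv fullv (lower_central k') else fullv.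

Definition lie_nilpotent : Prop := exists k, lower_central k = 0%VS.

End Nilpotent.

Definition invariant_form (F : fieldType) (g : lmodType F)
    (br : g -> g -> g) (f : g -> g -> F) : Prop :=
  forall x y z, f (br x y) z = - f y (br x z).

(* Not necessarily associative products on a finite dimensional space. *)
Section NonAssociative.
Variables (F : fieldType) (A : vectType F) (mul : A -> A -> A).

Definition has_unit : Prop := exists e, left_id e mul /\ right_id e mul.

Definition two_sided_ideal (I : {vspace A}) : Prop :=
  forall a x, x \in I -> mul a x \in I /\ mul x a \in I.

Definition simple_algebra : Prop :=
  [/\ bilinear_for *:%R *:%R mul, has_unit
    & forall I : {vspace A}, two_sided_ideal I -> I = 0%VS \/ I = fullv].

Definition commutator (a b : A) : A := mul a b - mul b a.

End NonAssociative.

(* The scalar component of the underlying space F x g is F^o, which is F viewed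
   as a vector space over itself. *)
Definition alg_mul (F : fieldType) (g : vectType F)
    (br : g -> g -> g) (f : g -> g -> F) (a b : F^o * g) : F^o * g :=
  (a.1 * b.1 + f a.2 b.2, a.1 *: b.2 + b.1 *: a.2 + 2^-1 *: br a.2 b.2).

(* The quotient vector space V / U, on top of the quotient of additive groups. *)
Section QuotientSpace.
Variables (F : fieldType) (V : vectType F) (U : {vspace V}).

Definition quotv : Type := Quotient.quot (pred_of_vspace U : zmodClosed V).

HB.instance Definition _ := GRing.Zmodule.on quotv.
HB.instance Definition _ := Quotient.on quotv.

Lemma quotv_eqP (x y : V) : reflect (\pi_quotv x = \pi_quotv y) (x - y \in U).
Proof.
by rewrite -[_ \in U]/(_ \in (pred_of_vspace U : zmodClosed V))
           Quotient.idealrBE; apply: eqP.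
Qed.

Lemma quotv_piD : {morph \pi_quotv : x y / x + y}.
Proof. by move=> x y; rewrite !piE. Qed.

Definition quotv_scale (a : F) (u : quotv) : quotv := \pi_quotv (a *: repr u).

Lemma quotv_scaleE a x : quotv_scale a (\pi_quotv x) = \pi_quotv (a *: x).
Proof.
apply/quotv_eqP; rewrite -scalerBr memvZ //.
by apply/quotv_eqP; rewrite reprK.
Qed.

Fact quotv_scaleA a b u :
  quotv_scale a (quotv_scale b u) = quotv_scale (a * b) u.
Proof. by rewrite -[u]reprK (quotv_scaleE b) !quotv_scaleE scalerA. Qed.

Fact quotv_scale1 : left_id 1 quotv_scale.
Proof. by move=> u; rewrite -[u]reprK quotv_scaleE scale1r. Qed.

Fact quotv_scaleDr : right_distributive quotv_scale +%R.
Proof.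
move=> a u v; rewrite -[u]reprK -[v]reprK -quotv_piD !quotv_scaleE.
by rewrite scalerDr quotv_piD.
Qed.

Fact quotv_scaleDl u : {morph quotv_scale^~ u : a b / a + b}.
Proof.
by move=> a b; rewrite -[u]reprK !quotv_scaleE scalerDl quotv_piD.
Qed.

HB.instance Definition _ := GRing.Zmodule_isLmodule.Build F quotv
  quotv_scaleA quotv_scale1 quotv_scaleDr quotv_scaleDl.

(* The operation induced on V / U by op, computed on chosen representatives;
   it is the induced one exactly when \pi is a morphism from op to quotv_op. *)
Definition quotv_op (op : V -> V -> V) (u v : quotv) : quotv :=
  \pi_quotv (op (repr u) (repr v)).

End QuotientSpace.

(* Main.v *)
Require Import Defs.
From HB Require Import structures.
From mathcomp Require Import all_boot all_algebra.
From mathcomp Require Import generic_quotient ring_quotient.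

Import GRing.Theory.
Local Open Scope ring_scope.
Local Open Scope quotient_scope.

(** Write an element of the algebra as (xi, x). Since [f] is symmetric and the
    bracket is alternating, half the sum and the difference of the products of
    (xi, x) with (0, y) on the two sides are
      (f x y, xi y)   and   (0, [x, y]).

    If [f] is non-degenerate, a two-sided ideal I containing some (0, x) with
    x != 0 contains (f x y, 0) for every y, hence the unit. If I contains
    (xi, x) with xi != 0, then either x = 0 and the unit is in I, or, as
    dim g > 1, some y != 0 is orthogonal to x, and then (f x y, xi y) = (0, xi y)
    brings one back to the previous case. Conversely, by invariance, 0 x rad f
    is a two-sided ideal; it does not contain the unit, so it vanishes when the
    algebra is simple.

    The commutator of (xi, x) and (eta, y) is (0, [x, y]), so the second
    projection identifies the quotient by F (1, 0), together with the induced
    bracket, with g; the Lie axioms transfer along this bijection. *)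

(** * Lie brackets *)

Section LieBracketTheory.
Set Implicit Arguments.
Unset Strict Implicit.
Variables (F : fieldType) (g : lmodType F) (br : g -> g -> g).
Hypothesis br_lie : is_lie_bracket br.

Lemma lie_bracketPl y a : {morph br^~ y : u v / a *: u + v}.
Proof. by case: br_lie => -[brl _] _ _ u v; apply: brl. Qed.

Lemma lie_bracketPr x a : {morph br x : u v / a *: u + v}.
Proof. by case: br_lie => -[_ brr] _ _ u v; apply: brr. Qed.

Lemma lie_bracketDl y : {morph br^~ y : u v / u + v}.
Proof. by move=> u v; have /= := lie_bracketPl y 1 u v; rewrite !scale1r. Qed.

Lemma lie_bracketDr x : {morph br x : u v / u + v}.
Proof. by move=> u v; have /= := lie_bracketPr x 1 u v; rewrite !scale1r. Qed.

Lemma lie_bracket0l y : br 0 y = 0.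
Proof. by apply: (addrI (br 0 y)); rewrite -lie_bracketDl !addr0. Qed.

Lemma lie_bracket0r x : br x 0 = 0.
Proof. by apply: (addrI (br x 0)); rewrite -lie_bracketDr !addr0. Qed.

Lemma lie_bracketC x y : br y x = - br x y.
Proof.
case: (br_lie) => _ brxx _; apply/eqP; rewrite -addr_eq0.
have := brxx (x + y); rewrite lie_bracketDl !lie_bracketDr !brxx add0r addr0.
by rewrite addrC => ->.
Qed.

(** The Lie axioms pull back along injective linear maps. *)
Lemma is_lie_bracket_inj (V : lmodType F) (brV : V -> V -> V)
    (phi : {linear V -> g}) :
  injective phi -> {morph phi : x y / brV x y >-> br x y} -> is_lie_bracket brV.
Proof.
case: (br_lie) => _ brxx brJ phi_inj phiM; split.
- by split=> [y | x] a u v; apply: phi_inj;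
    rewrite phiM !linearP /= !phiM ?lie_bracketPl ?lie_bracketPr.
- by move=> x; apply: phi_inj; rewrite phiM brxx linear0.
- by move=> x y z; apply: phi_inj; rewrite !linearD /= !phiM brJ linear0.
Qed.

End LieBracketTheory.

(** * Symmetric bilinear forms *)

Section SymmetricForm.
Set Implicit Arguments.
Unset Strict Implicit.
Variables (F : fieldType) (g : vectType F) (f : {symmetric g}).

Lemma symmetric_formC x y : f x y = f y x.
Proof. by rewrite hermitian_subproof expr0 mul1r. Qed.

Lemma symmetric_formPr x a u v : f x (a *: u + v) = a * f x u + f x v.
Proof. by rewrite linearPr. Qed.

Lemma symmetric_formPl y a u v : f (a *: u + v) y = a * f u y + f v y.
Proof. by rewrite linearPl. Qed.

Lemma nondegenerate_neq0 x :
  nondegenerate f -> x != 0 -> exists y, f x y != 0.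
Proof.
move=> /eqP rad0 x_neq0.
have /mem_orthovPn[y _ fxy] : x \notin orthov f fullv by rewrite rad0 memv0.
by exists y.
Qed.

Lemma exists_orthogonal x :
  (1 < \dim {:g})%N -> exists2 y, y != 0 & f x y = 0.
Proof.
move=> dim_gt1; have := leq_dim_orthov1 f x fullv; rewrite capfv => le_dim.
have orth_neq0 : orthov f <[x]> != 0%VS.
  by rewrite -dimv_eq0 -lt0n (leq_trans _ le_dim) // -subn1 subn_gt0.
exists (vpick (orthov f <[x]>)); first by rewrite vpick0.
rewrite symmetric_formC; apply: (mem_orthovP (memv_pick (orthov f <[x]>))).
exact: memv_line.
Qed.

End SymmetricForm.

(** * The algebra F x g: product and commutator *)

Section FormAlgebra.
Set Implicit Arguments.
Unset Strict Implicit.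
Variables (F : fieldType) (g : vectType F) (br : g -> g -> g).
Variable f : {symmetric g}.
Hypotheses (two_neq0 : 2 != 0 :> F) (br_lie : is_lie_bracket br).

Local Notation mul := (alg_mul br f).
Local Notation A := (F^o * g)%type.

(** Linearity of the second component of the product in one argument, with
    scalars of type [F]. In a component of an element of the algebra they have
    type [F^o], whose scaling is convertible but not syntactically equal, so
    that rewriting with the module laws would fail there. *)
Lemma alg_mul_snd_linear (a xi1 xi2 eta c : F) (u v1 v2 w1 w2 : g) :
  (a * xi1 + xi2) *: u + eta *: (a *: v1 + v2) + c *: (a *: w1 + w2) =
  a *: (xi1 *: u + eta *: v1 + c *: w1) + (xi2 *: u + eta *: v2 + c *: w2).
Proof.
rewrite scalerDl !scalerDr !scalerA [eta * a]mulrC [c * a]mulrC.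
by rewrite [RHS]addrACA [X in _ = X + _]addrACA.
Qed.

Lemma alg_mul_bilinear : bilinear_for *:%R *:%R mul.
Proof.
split=> [[eta y] | [xi x]] a [xi1 x1] [xi2 x2]; rewrite /alg_mul /=;
  congr (_, _) => /=.
- by rewrite symmetric_formPl mulrDl scalerDr -scalerAl addrACA.
- by rewrite (lie_bracketPl br_lie); apply: alg_mul_snd_linear.
- by rewrite symmetric_formPr mulrDr scalerDr -scalerAr addrACA.
- rewrite (lie_bracketPr br_lie) ![xi *: _ + _]addrC; apply: alg_mul_snd_linear.
Qed.

Lemma alg_mul1l : left_id ((1, 0) : A) mul.
Proof.
case=> xi x; rewrite /alg_mul /= linear0l (lie_bracket0l br_lie).
by rewrite mul1r scale1r !scaler0 !addr0.
Qed.

Lemma alg_mul1r : right_id ((1, 0) : A) mul.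
Proof.
case=> xi x; rewrite /alg_mul /= linear0r (lie_bracket0r br_lie).
by rewrite mulr1 scale1r !scaler0 add0r !addr0.
Qed.

Lemma alg_mul_has_unit : has_unit mul.
Proof. by exists (1, 0); split; [apply: alg_mul1l | apply: alg_mul1r]. Qed.

Lemma commutator_alg_mul (a b : A) : commutator mul a b = (0, br a.2 b.2).
Proof.
case: a b => [xi x] [eta y]; rewrite /commutator /alg_mul /=; congr (_, _) => /=.
  by rewrite [eta * xi]mulrC symmetric_formC subrr.
rewrite (lie_bracketC br_lie x y) scalerN [eta *: x + _]addrC opprD opprK addrACA.
by rewrite subrr add0r -mulr2n -scaler_nat scalerA mulfV // scale1r.
Qed.

(** * Two-sided ideals and non-degeneracy *)

(** The Jordan product (half the sum of the two products) of (xi, x) and (0, y):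
    symmetrizing cancels the bracket. *)
Lemma alg_mul_jordan (xi : F) (x y : g) :
  2^-1 *: (mul (xi, x) (0, y) + mul (0, y) (xi, x)) = (f x y, xi *: y) :> A.
Proof.
rewrite /alg_mul /= mulr0 mul0r !scale0r !add0r addr0 symmetric_formC.
rewrite (lie_bracketC br_lie x y) scalerN; congr (_, _) => /=.
  by rewrite -mulr2n -[f y x *+ 2]mulr_natl; exact: (mulKf two_neq0).
by rewrite addrACA subrr addr0 -mulr2n -scaler_nat scalerA mulVf // scale1r.
Qed.

Lemma ideal_jordan (I : {vspace A}) (xi : F) (x y : g) :
  two_sided_ideal mul I -> (xi, x) \in I -> (f x y, xi *: y) \in I.
Proof.
move=> idealI /(idealI (0, y))[mul_l mul_r].
by rewrite -alg_mul_jordan; apply/memvZ/memvD.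
Qed.

Lemma ideal_unit_full (I : {vspace A}) (xi : F) :
  two_sided_ideal mul I -> xi != 0 -> (xi, 0) \in I -> I = fullv.
Proof.
move=> idealI xi_neq0 xiI; have oneI : (1, 0) \in I.
  suff -> : ((1, 0) : A) = xi^-1 *: ((xi, 0) : A) by apply: memvZ.
  by congr (_, _) => /=; rewrite ?scaler0 //; apply/esym/mulVf.
apply/vspaceP=> a; rewrite memvf -[a]alg_mul1l.
by have [] := idealI a _ oneI.
Qed.

Lemma nondegenerate_ideal (I : {vspace A}) :
  (1 < \dim {:g})%N -> nondegenerate f -> two_sided_ideal mul I ->
  I = 0%VS \/ I = fullv.
Proof.
move=> dim_gt1 f_nd idealI.
have full_of_vector x : x != 0 -> (0, x) \in I -> I = fullv.
  move=> /(nondegenerate_neq0 f_nd)[y fxy] /(ideal_jordan y idealI).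
  by rewrite scale0r; apply: ideal_unit_full.
have [-> | I_neq0] := eqVneq I 0%VS; [by left | right].
have := memv_pick I; have: vpick I != 0 by rewrite vpick0.
case: (vpick I) => [xi x] pick_neq0 xI.
have [xi0 | xi_neq0] := eqVneq xi 0.
  rewrite {}xi0 in pick_neq0 xI; apply: (full_of_vector x) => //.
  by apply: contraNneq pick_neq0 => ->.
have [x0 | x_neq0] := eqVneq x 0.
  by rewrite x0 in xI; apply: ideal_unit_full xI.
have [y y_neq0 fxy0] := exists_orthogonal f x dim_gt1.
apply: (full_of_vector (xi *: y)); first by rewrite scaler_eq0 negb_or xi_neq0.
by have := ideal_jordan y idealI xI; rewrite fxy0.
Qed.

Lemma nondegenerate_simple :
  (1 < \dim {:g})%N -> nondegenerate f -> simple_algebra mul.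
Proof.
move=> dim_gt1 f_nd; split; [exact: alg_mul_bilinear | exact: alg_mul_has_unit |].
by move=> I; apply: nondegenerate_ideal.
Qed.

Lemma inr_linear : linear (fun x : g => (0, x) : A).
Proof. by move=> a x y; congr (_, _) => /=; rewrite scaler0 addr0. Qed.

(** The subspace 0 x rad f, obtained as the image of the radical under the
    inclusion of g as second factor. *)
Definition radical_ideal : {vspace A} :=
  (linfun (fun x : g => (0, x) : A) @: orthov f fullv)%VS.

Lemma mem_radical_ideal (a : A) :
  (a \in radical_ideal) = (a.1 == 0) && (a.2 \in orthov f fullv).
Proof.
pose inr_lin : {linear g -> A} :=
  HB.pack (fun x : g => (0, x) : A)
    (GRing.isLinear.Build F g A _ (fun x : g => (0, x) : A) inr_linear).
have inrE x : linfun (fun x : g => (0, x) : A) x = (0, x).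
  exact: (lfunE inr_lin).
apply/memv_imgP/andP => [[x xrad ->] | ]; first by rewrite inrE /= eqxx.
by case: a => xi x /= [/eqP-> xrad]; exists x; rewrite ?inrE.
Qed.

Lemma radical_idealP :
  invariant_form br f -> two_sided_ideal mul radical_ideal.
Proof.
move=> f_inv [eta y] [xi x]; rewrite !mem_radical_ideal /=.
case/andP=> /eqP-> /mem_orthovP xrad.
have fxz z : f x z = 0 by rewrite xrad ?memvf.
(* f [x, y] z = - f [y, x] z = f x [y, z] = 0 *)
have brxrad : br x y \in orthov f fullv.
  by apply/mem_orthovP => z _; rewrite (lie_bracketC br_lie y x) linearNl /=
    f_inv fxz !oppr0.
rewrite mulr0 mul0r !scale0r addr0 !add0r [f y x]symmetric_formC fxz eqxx /=.
split; last by rewrite rpredD ?rpredZ //; apply/mem_orthovP => z _.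
rewrite (lie_bracketC br_lie x y) rpredD ?rpredZ ?rpredN //.
by apply/mem_orthovP => z _.
Qed.

Lemma simple_nondegenerate :
  invariant_form br f -> simple_algebra mul -> nondegenerate f.
Proof.
move=> f_inv [_ _ /(_ _ (radical_idealP f_inv))[rad0 | rad_full]]; last first.
  have : ((1, 0) : A) \in radical_ideal by rewrite rad_full memvf.
  by rewrite mem_radical_ideal /= oner_eq0.
rewrite /nondegenerate -subv0; apply/subvP=> x xrad.
have : ((0, x) : A) \in radical_ideal by rewrite mem_radical_ideal /= eqxx.
by rewrite rad0 !memv0 xpair_eqE eqxx.
Qed.

(** * The quotient by the line of the unit *)

Local Notation Q := (quotv <[((1, 0)%R : A)]>%VS).
Local Notation brQ := (quotv_op (commutator mul) : Q -> Q -> Q).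

(** The kernel of the second projection is F (1, 0). *)
Lemma quot_unit_eq (a b : A) : (\pi_Q a = \pi_Q b) <-> (a.2 = b.2).
Proof.
split=> [/quotv_eqP/vlineP[k /(congr1 snd)/=] | ab2].
  by rewrite scaler0 => /eqP; rewrite subr_eq0 => /eqP.
apply/quotv_eqP/vlineP; exists (a.1 - b.1); case: a b ab2 => [xi x] [eta y] /= ->.
by congr (_, _) => /=; rewrite ?scaler0 ?subrr //; apply/esym/mulr1.
Qed.

(** The second projection, factored through the quotient by F (1, 0). *)
Definition quot_unit_snd (u : Q) : g := (repr u).2.

Lemma quot_unit_snd_pi (a : A) : quot_unit_snd (\pi_Q a) = a.2.
Proof. by apply/quot_unit_eq; rewrite reprK. Qed.

Lemma quot_unit_snd_linear : linear quot_unit_snd.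
Proof.
move=> k u v; rewrite -[u]reprK -[v]reprK -[k *: _]/(quotv_scale k _).
by rewrite quotv_scaleE -quotv_piD !quot_unit_snd_pi.
Qed.

Lemma quot_unit_snd_bij : bijective quot_unit_snd.
Proof.
exists (fun x => \pi_Q (0, x)) => [u | x]; last exact: quot_unit_snd_pi.
by rewrite -[RHS]reprK; apply/quot_unit_eq.
Qed.

Lemma quot_unit_snd_morph : {morph quot_unit_snd : u v / brQ u v >-> br u v}.
Proof. by move=> u v; rewrite /quotv_op quot_unit_snd_pi commutator_alg_mul. Qed.

Lemma pi_quot_unit_morph :
  {morph \pi_Q : a b / commutator mul a b >-> brQ a b}.
Proof.
move=> a b; apply/quot_unit_eq; rewrite !commutator_alg_mul /=.
by rewrite -[(repr (\pi_Q a)).2]/(quot_unit_snd _)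
           -[(repr (\pi_Q b)).2]/(quot_unit_snd _) !quot_unit_snd_pi.
Qed.

Lemma quot_unit_lie : is_lie_bracket brQ /\ lie_isomorphic brQ br.
Proof.
pose phi : {linear Q -> g} :=
  HB.pack quot_unit_snd
    (GRing.isLinear.Build F Q g _ quot_unit_snd quot_unit_snd_linear).
have phi_bij : bijective phi by exact: quot_unit_snd_bij.
have phiM : {morph phi : u v / brQ u v >-> br u v} by exact: quot_unit_snd_morph.
split; last by exists phi.
exact: (is_lie_bracket_inj br_lie (bij_inj phi_bij)).
Qed.

End FormAlgebra.

Theorem theorem4p1 (F : fieldType) (g : vectType F)
    (br : g -> g -> g) (f : {symmetric g}) :
  [pchar F] =i pred0 ->
  is_lie_bracket br ->
  lie_nilpotent br ->
  invariant_form br f ->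
  (exists x y, f x y != 0) ->
  ((1 < \dim {:g})%N -> (nondegenerate f <-> simple_algebra (alg_mul br f)))
  /\
  (let comm := commutator (alg_mul br f) in
   let e : F^o * g := (1, 0) in
   let Q := quotv <[e]>%VS in
   let brQ := quotv_op comm : Q -> Q -> Q in
   [/\ {morph \pi_Q : a b / comm a b >-> brQ a b},
       is_lie_bracket brQ
     & lie_isomorphic brQ br]).
Proof.
move=> charF0 br_lie _ f_inv _.
have two_neq0 : 2 != 0 :> F by move: charF0 => /pcharf0P ->.
split=> [dim_gt1 | comm e Q brQ].
  split; first exact: nondegenerate_simple.
  exact: simple_nondegenerate.
have [lieQ isoQ] := quot_unit_lie f two_neq0 br_lie.
by split; first exact: pi_quot_unit_morph.
Qed.
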